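(* Let $n\ge1$ and $\phi\in\mathcal{B}_n$. Consider the following nine conditions: - (a1) $t_1^\phi=t_1$; (a2) $t_1^\phi\in(t_1{\star})\setminus\{t_1\}$; (a3) $t_1^\phi\notin(t_1{\star})$; - (b1) $\phi$ is $\sigma_1$-neutral; (b2) $\phi$ is $\sigma_1$-negative; (b3) $\phi$ is $\sigma_1$-positive; - (c1) $(t_1{\star})^\phi=(t_1{\star})$; (c2) $(t_1{\star})^\phi\subsetneq(t_1{\star})$; (c3) $(t_1{\star})^\phi\supsetneq(t_1{\star})$. Then (a1)$\Leftrightarrow$(b1)$\Leftrightarrow$(c1), (a2)$\Leftrightarrow$(b2)$\Leftrightarrow$(c2), and (a3)$\Leftrightarrow$(b3)$\Leftrightarrow$(c3). Moreover, exactly one of (b1), (b2), (b3) holds.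
   Context: $\Sigma_{0,1,n}$ is the free group with free basis $t_1,\dots,t_n$, and $z_1:=(t_1\cdots t_n)^{-1}$. Notation: $\overline a:=a^{-1}$, $a^b:=b^{-1}ab$. Automorphisms act on the right and are written as exponents; they compose left to right. $\mathcal{B}_n$ is the group of all automorphisms $\phi$ of $\Sigma_{0,1,n}$ such that $z_1^\phi=z_1$ and $\phi$ permutes the set of conjugacy classes $\{[t_1],\dots,[t_n]\}$. For $i\in\{1,\dots,n-1\}$, $\sigma_i$ is given by $t_k^{\sigma_i}=t_k$ for $k\notin\{i,i+1\}$, $t_i^{\sigma_i}=t_{i+1}$, and $t_{i+1}^{\sigma_i}=\overline t_{i+1}t_it_{i+1}$. $(w{\star})$ denotes the set of elements whose reduced word in $t_1^{\pm1},\dots,t_n^{\pm1}$ begins with the reduced word of $w$, and $(t_1{\star})^\phi=\{x^\phi: x\in(t_1{\star})\}$. The following notions are used: - $\phi$ is $\sigma_1$-neutral if $\phi$ lies in the subgroup generated by $\sigma_2,\dots,\sigma_{n-1}$. - $\phi$ is $\sigma_1$-positive if $n\ge2$ and $\phi$ is a product of a finite sequence of elements of $\{\sigma_1,\dots,\sigma_{n-1}\}\cup\{\sigma_2^{-1},\dots,\sigma_{n-1}^{-1}\}$ in which $\sigma_1$ occurs at least once. - $\phi$ is $\sigma_1$-negative if $\phi^{-1}$ is $\sigma_1$-positive. *)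

(* Defs.v *)
(* Concrete model of the free group Sigma_{0,1,n} by reduced words. *)
From mathcomp Require Import all_boot all_fingroup.
Set Implicit Arguments. Unset Strict Implicit. Unset Printing Implicit Defensive.

(* A letter (k, true) stands for t_{k+1}, (k, false) for its inverse (0-based indices). *)
Definition letter := (nat * bool)%type.
Definition word := seq letter.

Definition red (w : word) : word :=
  foldr (fun a acc => match acc with
                      | b :: r => if (a.1 == b.1) && (a.2 != b.2) then r else a :: acc
                      | [::] => [:: a] end) [::] w.

Definition isword (n : nat) (w : word) : bool :=
  (red w == w) && all (fun a => a.1 < n) w.

Definition wmul (u v : word) : word := red (u ++ v).
Definition winv (w : word) : word := rev (map (fun a => (a.1, ~~ a.2)) w).
Definition gen (k : nat) : word := [:: (k, true)].

Definition z1 (n : nat) : word := winv [seq (k, true) | k <- iota 0 n].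

(* An endomorphism is given by the images of the generators; ext f is its action. *)
Definition endo := nat -> word.
Definition ext (f : endo) (w : word) : word :=
  red (flatten (map (fun a => if a.2 then f a.1 else winv (f a.1)) w)).
Definition idE : endo := gen.
(* composition left to right: x^(f g) = (x^f)^g *)
Definition comp (f g : endo) : endo := fun k => ext g (f k).
Definition aut_eq (n : nat) (f g : endo) : Prop :=
  forall k, k < n -> red (f k) = red (g k).
Definition is_inverse (n : nat) (f g : endo) : Prop :=
  aut_eq n (comp f g) idE /\ aut_eq n (comp g f) idE.

Definition isAut (n : nat) (f : endo) : Prop :=
  (forall k, k < n -> isword n (f k)) /\
  exists g, (forall k, k < n -> isword n (g k)) /\ is_inverse n f g.

Definition conj_word (a b : word) : word := wmul (winv b) (wmul a b).

Definition inB (n : nat) (f : endo) : Prop :=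
  isAut n f /\ ext f (z1 n) = z1 n /\
  exists p : {perm 'I_n}, forall i : 'I_n,
    exists c, isword n c /\ ext f (gen i) = conj_word (gen (p i)) c.

(* sigma_{i+1} and its inverse (0-based i) *)
Definition sigma (i : nat) : endo := fun k =>
  if k == i then gen i.+1
  else if k == i.+1 then [:: (i.+1, false); (i, true); (i.+1, true)]
  else gen k.
Definition sigma_inv (i : nat) : endo := fun k =>
  if k == i then [:: (i, true); (i.+1, true); (i, false)]
  else if k == i.+1 then gen i
  else gen k.

(* braid words: (i, true) = sigma_{i+1}, (i, false) = sigma_{i+1}^{-1} *)
Definition bw_eval (s : seq (nat * bool)) : endo :=
  foldl (fun f a => comp f (if a.2 then sigma a.1 else sigma_inv a.1)) idE s.

Definition sigma1_neutral (n : nat) (f : endo) : Prop :=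
  exists s : seq (nat * bool),
    all (fun a => (1 <= a.1) && (a.1.+1 < n)) s /\ aut_eq n f (bw_eval s).

Definition sigma1_positive (n : nat) (f : endo) : Prop :=
  2 <= n /\ exists s : seq (nat * bool),
    all (fun a => (a.1.+1 < n) && ((a.1 == 0) ==> a.2)) s /\
    has (fun a => a.1 == 0) s /\ aut_eq n f (bw_eval s).

Definition sigma1_negative (n : nat) (f : endo) : Prop :=
  exists g, is_inverse n f g /\ sigma1_positive n g.

Definition t1star (n : nat) (w : word) : Prop := isword n w /\ take 1 w = gen 0.
Definition t1star_img (n : nat) (f : endo) (w : word) : Prop :=
  exists x, t1star n x /\ ext f x = w.

(* Main.v *)
From HB Require Import structures.
From mathcomp Require Import all_boot all_fingroup.
From mathcomp Require Import zify.
Require Import Defs.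

(** Write t_k^phi as the reduced word w_k^-1 t_(p k) w_k. If a factor
    w_k w_(k+1)^-1 of the product of these words absorbs a neighbouring letter
    t_(p k) or t_(p (k+1)), then left multiplication by sigma_k or its inverse
    shortens phi. If t_1^phi starts with t_1, such a move other than the one
    that would introduce sigma_1 always exists unless phi = 1: otherwise all
    factors but the first survive in t_1 ... t_n, and together they are too
    long. So (a1) and (a2) produce words without sigma_1.

    The involution inverting each prefix t_1 ... t_k conjugates sigma_i to its
    inverse and sends every nontrivial element that does not start with t_1 to
    one that does, so (a3) for phi reduces to (a2) for its conjugate.

    Finally sigma_1^-1 maps the set of words starting with t_1 properly into
    itself and the other sigma_i preserve this set, so each (b) gives the
    corresponding (c). Since the (a) are
    exhaustive and the (c) mutually exclusive, all implications reverse. *)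

Set Implicit Arguments.
Unset Strict Implicit.
Unset Printing Implicit Defensive.

Local Open Scope group_scope.

(** * Reduced words and free reduction *)

Definition linv (a : letter) : letter := (a.1, ~~ a.2).

Lemma linvK : involutive linv.
Proof. by case=> k b; rewrite /linv /= negbK. Qed.

Lemma eq_linv (a b : letter) : (b == linv a) = (a.1 == b.1) && (a.2 != b.2).
Proof.
by case: a b => k [] [l []]; rewrite /linv !xpair_eqE /= ?andbF ?andbT // eq_sym.
Qed.

Definition noncancel (a b : letter) := b != linv a.

Lemma noncancelC a b : noncancel (linv b) (linv a) = noncancel a b.
Proof. by rewrite /noncancel linvK eq_sym. Qed.

Definition reduced (w : word) := sorted noncancel w.

Definition push (a : letter) (w : word) : word :=
  if w is b :: r then if b == linv a then r else a :: w else [:: a].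

Lemma red_cons a w : red (a :: w) = push a (red w).
Proof. by rewrite /push /=; case: (red w) => // b r; rewrite eq_linv. Qed.

Lemma push_reduced a w : reduced w -> reduced (push a w).
Proof.
case: w => // b r rw; rewrite /push; case: ifP => [_|ne].
  exact: path_sorted rw.
by rewrite /reduced /= /noncancel ne.
Qed.

Lemma red_reduced w : reduced (red w).
Proof. by elim: w => // a w IH; rewrite red_cons push_reduced. Qed.

Lemma red_id w : reduced w -> red w = w.
Proof.
elim: w => // a w IH rw; rewrite red_cons IH; last exact: path_sorted rw.
by case: w rw {IH} => // b w /andP[ne _]; rewrite /push (negbTE ne).
Qed.

Lemma reducedE w : reduced w = (red w == w).
Proof. by apply/idP/eqP => [/red_id|<-] //; apply: red_reduced. Qed.

Lemma redK w : red (red w) = red w.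
Proof. exact/red_id/red_reduced. Qed.

(** If [push a] deletes a leading [linv a], reducedness keeps the next letter from being [a], so
    pushing [linv a] restores the deleted letter instead of cancelling again. *)
Lemma push_linv a w : reduced w -> push (linv a) (push a w) = w.
Proof.
case: w => [|b r]; rewrite /push; first by rewrite linvK eqxx.
case: eqP => [-> |_ _]; last by rewrite linvK eqxx.
by case: r => // c r /andP[/negbTE ne _]; rewrite ne.
Qed.

Lemma red_catr u v : red (u ++ red v) = red (u ++ v).
Proof. by elim: u => [|a u IH]; rewrite ?redK // !cat_cons !red_cons IH. Qed.

Lemma red_push_cat a r v : red (push a r ++ v) = push a (red (r ++ v)).
Proof.
case: r => [|b r]; first by rewrite -red_cons.
rewrite {1}/push; case: (b =P linv a) => [->|_]; last by rewrite -red_cons.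
by rewrite cat_cons red_cons -{1}(linvK a) push_linv // red_reduced.
Qed.

Lemma red_catl u v : red (red u ++ v) = red (u ++ v).
Proof. by elim: u => // a u IH; rewrite cat_cons !red_cons red_push_cat IH. Qed.

Lemma size_red w : size (red w) <= size w.
Proof.
elim: w => // a w IH; rewrite red_cons /push /=.
by case: (red w) IH => [|b r] //= IH; case: ifP => _ //=; lia.
Qed.

Lemma winvE w : winv w = rev (map linv w).
Proof. by []. Qed.

Lemma winv_cons a w : winv (a :: w) = rcons (winv w) (linv a).
Proof. by rewrite !winvE /= rev_cons. Qed.

Lemma winv_cat u v : winv (u ++ v) = winv v ++ winv u.
Proof. by rewrite !winvE map_cat rev_cat. Qed.

Lemma winvK : involutive winv.
Proof. by move=> w; rewrite !winvE map_rev revK mapK //; apply: linvK. Qed.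

Lemma size_winv w : size (winv w) = size w.
Proof. by rewrite winvE size_rev size_map. Qed.

Lemma winv_reduced w : reduced (winv w) = reduced w.
Proof.
rewrite /reduced winvE rev_sorted sorted_map.
by apply: eq_sorted => a b /=; rewrite noncancelC.
Qed.

Lemma red_winvl w : red (winv w ++ w) = [::].
Proof.
elim: w => // a w IH; rewrite winv_cons cat_rcons -red_catr !red_cons.
by rewrite -{1}(linvK a) -{2}(linvK a) push_linv ?red_reduced // red_catr.
Qed.

(** * The free group on countably many generators, one reduced word per element *)

Record fgroup := Fg { fgval : word; fg_reduced : reduced fgval }.

HB.instance Definition _ := [isSub for fgval].
HB.instance Definition _ := [Choice of fgroup by <:].

Definition cls (w : word) : fgroup := Fg (red_reduced w).

Lemma cls_eq u v : red u = red v -> cls u = cls v.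
Proof. by move=> e; apply: val_inj. Qed.

Lemma clsK (x : fgroup) : cls (val x) = x.
Proof. by apply: val_inj; apply: red_id (fg_reduced x). Qed.

Lemma cls_red w : cls (red w) = cls w.
Proof. by apply: cls_eq; rewrite redK. Qed.

Definition fmul (x y : fgroup) : fgroup := cls (val x ++ val y).
Definition finv (x : fgroup) : fgroup := cls (winv (val x)).

Lemma fmulE u v : fmul (cls u) (cls v) = cls (u ++ v).
Proof. by apply: cls_eq; rewrite /= red_catl red_catr. Qed.

Lemma fmulA : associative fmul.
Proof.
by move=> x y z; rewrite -(clsK x) -(clsK y) -(clsK z) !fmulE catA.
Qed.

Lemma fmul1 : left_id (cls [::]) fmul.
Proof. by move=> x; rewrite -(clsK x) fmulE. Qed.

Lemma fmulr1 : right_id (cls [::]) fmul.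
Proof. by move=> x; rewrite -(clsK x) fmulE cats0. Qed.

Lemma fmulV : left_inverse (cls [::]) finv fmul.
Proof.
by move=> x; rewrite -[x in fmul _ x]clsK fmulE; apply: cls_eq; rewrite red_winvl.
Qed.

Lemma fmulrV : right_inverse (cls [::]) finv fmul.
Proof.
move=> x; rewrite -[x in fmul x _]clsK fmulE; apply: cls_eq.
by rewrite -{1}(winvK (val x)) red_winvl.
Qed.

HB.instance Definition _ := isGroup.Build fgroup fmulA fmul1 fmulr1 fmulV fmulrV.

Lemma cls_cat u v : cls (u ++ v) = cls u * cls v.
Proof. by rewrite -fmulE. Qed.

Lemma cls_winv w : cls (winv w) = (cls w)^-1.
Proof.
apply/esym/mulg1_eq; rewrite -cls_cat; apply: cls_eq.
by rewrite -{1}(winvK w) red_winvl.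
Qed.

Lemma cls_nil : cls [::] = 1.
Proof. by []. Qed.

Lemma val_mulg (x y : fgroup) : val (x * y) = red (val x ++ val y).
Proof. by []. Qed.

Lemma val_invg (x : fgroup) : val x^-1 = winv (val x).
Proof. by apply: red_id; rewrite winv_reduced fg_reduced. Qed.

Definition tgen (k : nat) : fgroup := cls (gen k).

(** * Homomorphisms out of the free group *)

Section Evaluation.
Variable G : groupType.
Implicit Types X Y : nat -> G.

Definition lval X (a : letter) : G := if a.2 then X a.1 else (X a.1)^-1.
Definition ev X (w : word) : G := \prod_(a <- w) lval X a.

Lemma lval_linv X a : lval X (linv a) = (lval X a)^-1.
Proof. by case: a => k []; rewrite /lval /= ?invgK. Qed.

Lemma ev_nil X : ev X [::] = 1.
Proof. by rewrite /ev big_nil. Qed.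

Lemma ev_cons X a w : ev X (a :: w) = lval X a * ev X w.
Proof. by rewrite /ev big_cons. Qed.

Lemma ev_cat X u v : ev X (u ++ v) = ev X u * ev X v.
Proof. by rewrite /ev big_cat. Qed.

Lemma ev_red X w : ev X (red w) = ev X w.
Proof.
elim: w => // a w IH; rewrite red_cons ev_cons -IH /push.
case: (red w) => [|b r]; first by rewrite ev_cons.
case: eqP => [->|_]; last by rewrite ev_cons.
by rewrite ev_cons lval_linv mulKVg.
Qed.

Lemma eq_ev_in n X Y w : (forall k, k < n -> X k = Y k) ->
  all (fun a : letter => a.1 < n) w -> ev X w = ev Y w.
Proof.
move=> eXY; elim: w => [|a w IH] /=; first by rewrite !ev_nil.
by case/andP=> lta /IH eqw; rewrite !ev_cons eqw /lval eXY.
Qed.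

Definition hom X (x : fgroup) : G := ev X (val x).

Lemma hom_cls X w : hom X (cls w) = ev X w.
Proof. exact: ev_red. Qed.

Lemma hom_div X : {morph hom X : x y / x * y^-1}.
Proof.
have homM x y : hom X (x * y) = hom X x * hom X y.
  by rewrite -{1}(clsK x) -{1}(clsK y) -cls_cat hom_cls ev_cat.
move=> x y; rewrite homM; congr (_ * _).
by apply/esym/mulg1_eq; rewrite -homM mulgV -cls_nil hom_cls ev_nil.
Qed.

HB.instance Definition _ X := isGroupMorphism.Build fgroup G (hom X) (hom_div X).

Lemma hom_tgen X k : hom X (tgen k) = X k.
Proof. by rewrite hom_cls ev_cons ev_nil mulg1. Qed.

End Evaluation.

Lemma ev_morph (G H : groupType) (f : UMagmaMorphism.type G H) X w :
  f (ev X w) = ev (f \o X) w.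
Proof.
elim: w => [|a w IH]; first by rewrite !ev_nil gmulf1.
by rewrite !ev_cons gmulfM IH /lval /=; case: ifP => // _; rewrite gmulfV.
Qed.

Lemma ev_tgen w : ev tgen w = cls w.
Proof.
elim: w => [|a w IH]; first by rewrite ev_nil.
rewrite ev_cons IH -cat1s cls_cat; congr (_ * _).
by case: a => k [] //; rewrite /lval /= -cls_winv.
Qed.

Lemma hom_comp (G H : groupType) (f : UMagmaMorphism.type G H) X x :
  f (hom X x) = hom (f \o X) x.
Proof. exact: ev_morph. Qed.

Lemma eq_hom (G : groupType) (X Y : nat -> G) : X =1 Y -> hom X =1 hom Y.
Proof. by move=> e x; apply: eq_bigr => a _; rewrite /lval e. Qed.

Lemma hom_id x : hom tgen x = x.
Proof. by rewrite /hom ev_tgen clsK. Qed.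

Lemma extE f w : ext f w = val (ev (fun k => cls (f k)) w).
Proof.
rewrite /ext -[red _]/(val (cls _)); congr val.
elim: w => [|a w IH]; first by rewrite ev_nil.
rewrite ev_cons -IH /= cls_cat; congr (_ * _).
by rewrite /lval; case: ifP => // _; rewrite cls_winv.
Qed.

(** * The action of braid words *)

Definition bgen (a : nat * bool) : nat -> fgroup :=
  fun k => cls ((if a.2 then sigma a.1 else sigma_inv a.1) k).

(** Letters act from left to right, as in [bw_eval], since automorphisms act on the right. *)
Definition bact (s : seq (nat * bool)) (x : fgroup) : fgroup :=
  foldl (fun y a => hom (bgen a) y) x s.

Lemma bgenE i b k : bgen (i, b) k =
  if b then if k == i then tgen i.+1 else if k == i.+1 then tgen i ^ tgen i.+1 else tgen k
  else if k == i then tgen i.+1 ^ (tgen i)^-1 else if k == i.+1 then tgen i else tgen k.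
Proof.
have e1 : cls [:: (i.+1, false); (i, true); (i.+1, true)] = tgen i ^ tgen i.+1.
  by rewrite conjgE -cls_winv -!cls_cat.
have e2 : cls [:: (i, true); (i.+1, true); (i, false)] = tgen i.+1 ^ (tgen i)^-1.
  by rewrite conjgE invgK -cls_winv -!cls_cat.
by rewrite /bgen /sigma /sigma_inv; case: b => /=; case: (k == i) => //; case: (k == _).
Qed.

Lemma bact_cat s1 s2 x : bact (s1 ++ s2) x = bact s2 (bact s1 x).
Proof. exact: foldl_cat. Qed.

Lemma bw_evalE s k : cls (bw_eval s k) = bact s (tgen k).
Proof.
elim/last_ind: s k => // s a IH k.
rewrite /bw_eval /bact !foldl_rcons -/(bact s _) -/(bw_eval s).
by rewrite -IH /comp hom_cls extE clsK.
Qed.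

Lemma bact_div s : {morph bact s : x y / x * y^-1}.
Proof.
by elim: s => // a s IH x y; rewrite /bact /= -/(bact s _) gmulfF IH.
Qed.

HB.instance Definition _ s := isGroupMorphism.Build fgroup fgroup (bact s) (bact_div s).

Definition flip (a : nat * bool) := (a.1, ~~ a.2).

Lemma bgenK a x : hom (bgen (flip a)) (hom (bgen a) x) = x.
Proof.
rewrite hom_comp -[RHS]hom_id; apply: eq_hom => k /=; case: a => i b; rewrite bgenE.
have ni : (i.+1 == i) = false by apply/eqP; lia.
rewrite /flip /=; case: (k =P i) => [->|/eqP/negbTE n1];
 last case: (k =P i.+1) => [->|/eqP/negbTE n2];
 by case: b => /=; rewrite ?gmulfJ ?gmulfV /= ?hom_tgen
    !bgenE ?eqxx ?ni ?eqxx ?n1 ?n2 ?conjgK ?conjgKV.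
Qed.

Lemma bactK s x : bact (rev (map flip s)) (bact s x) = x.
Proof.
elim/last_ind: s x => // s a IH x.
by rewrite map_rcons rev_rcons -cats1 bact_cat /bact /= bgenK -/(bact _ _) IH.
Qed.

Lemma bactVK s x : bact s (bact (rev (map flip s)) x) = x.
Proof.
have := bactK (rev (map flip s)) x; rewrite map_rev revK mapK //.
by case=> k b; rewrite /flip /= negbK.
Qed.

Arguments reduced : simpl never.
Arguments red : simpl never.

(** * First letters and cancellation in products *)

Definition starts (c : letter) (w : word) := ohead w == Some c.

Lemma startsP c w : reflect (exists r, w = c :: r) (starts c w).
Proof.
apply: (iffP eqP) => [|[r ->] //].
by case: w => // a r [->]; exists r.
Qed.

Lemma reduced_cons a w : reduced (a :: w) = ~~ starts (linv a) w && reduced w.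
Proof. by case: w => // b w; rewrite /reduced /= /noncancel /starts (inj_eq Some_inj). Qed.

Lemma reduced_cat a u b v :
  reduced (rcons u a ++ b :: v) = [&& reduced (rcons u a), noncancel a b & reduced (b :: v)].
Proof.
case: u => [|c u] /=; first by rewrite /reduced.
by rewrite /reduced /= cat_path last_rcons /=.
Qed.

Lemma positive_reduced (w : word) : all snd w -> reduced w.
Proof.
elim: w => // a w IH /= /andP[pa pw]; rewrite reduced_cons IH // andbT.
apply/negP=> /startsP[r e]; move: pw; rewrite e /= => /andP[].
by rewrite pa.
Qed.

(** Equal last letters of [a] and [b] cancel in a b^-1, and the first differing pair stops the
    process, so that [c] is the longest common suffix. *)
Lemma reduced_divr (a b : word) : reduced a -> reduced b ->
  exists a1 b1 c, [/\ a = a1 ++ c, b = b1 ++ c & red (a ++ winv b) = a1 ++ winv b1].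
Proof.
elim/last_ind: a b => [|a x IH] b.
  move=> _ rb; exists [::], b, [::]; rewrite !cats0; split=> //=.
  by rewrite red_id // winv_reduced.
case/lastP: b => [|b y] ra rb.
  by exists (rcons a x), [::], [::]; rewrite !cats0; split=> //; rewrite red_id.
have ra' : reduced a by move: ra; rewrite -cats1 => /cat_sorted2[].
have rb' : reduced b by move: rb; rewrite -cats1 => /cat_sorted2[].
have [<-|ne] := eqVneq x y; last first.
  exists (rcons a x), (rcons b y), [::]; rewrite !cats0; split=> //.
  rewrite red_id // -(cats1 b) winv_cat /= reduced_cat ra /noncancel /=.
  rewrite (inj_eq (inv_inj linvK)) eq_sym ne.
  by have := winv_reduced (rcons b y); rewrite rb -cats1 winv_cat.
have [a1 [b1 [c [ea eb er]]]] := IH b ra' rb'.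
exists a1, b1, (rcons c x); rewrite ea eb !rcons_cat; split=> //.
rewrite -er -!rcons_cat -ea -eb -(cats1 b) winv_cat cat_rcons /=.
by rewrite -red_catr !red_cons -{1}(linvK x) push_linv ?red_reduced // red_catr.
Qed.

(** * Conjugates of generators *)

Definition elt (a : nat * word) : fgroup := tgen a.1 ^ cls a.2.

(** Exactly the condition that makes the concatenation w^-1 t_p w reduced, for [a] = (p, w). *)
Definition canon (a : nat * word) :=
  reduced a.2 && ~~ has (fun b => starts (a.1, b) a.2) [:: true; false].

Lemma canonP a : canon a -> reduced a.2 /\ forall b, ~~ starts (a.1, b) a.2.
Proof.
case/andP=> ra; rewrite /= orbF negb_or => /andP[st sf].
by split=> // -[].
Qed.

(** Leading letters t_p^±1 of [x] commute with t_p and can be stripped, which never lengthens the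
    conjugator. *)
Lemma conj_canon p x : exists w,
  [/\ canon (p, w), size w <= size (val x) & tgen p ^ x = elt (p, w)].
Proof.
case: x => w rw; have -> : Fg rw = cls w by apply: val_inj; rewrite /= red_id.
elim: w rw => [_|a w IH rw]; first by exists [::].
have [e|ne] := eqVneq a.1 p; last first.
  exists (a :: w); split=> //; last by rewrite /= red_id.
  rewrite /canon /= rw /= /starts /= !(inj_eq Some_inj).
  by case: a {IH rw} ne => k b /= ne; rewrite !xpair_eqE (negbTE ne).
have rw' : reduced w := path_sorted rw.
have [w' [cw' le e']] := IH rw'; exists w'; split=> //.
  by move: le; rewrite /= !red_id // => /leqW.
rewrite -e' -cat1s cls_cat conjgM; congr (_ ^ _).
case: a e {rw} => k [] /= ->; first by rewrite conjgE mulKg.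
by rewrite (_ : cls _ = (tgen p)^-1) ?conjgE ?invgK ?mulgV ?mulg1 // -cls_winv.
Qed.

Lemma val_elt a : canon a -> val (elt a) = winv a.2 ++ (a.1, true) :: a.2.
Proof.
case/canonP=> ra na; rewrite /elt conjgE -cls_winv -!cls_cat /= ?(red_id ra).
apply: red_id; case: a ra na => p [|b w] //= ra na.
rewrite winv_cons reduced_cat -winv_cons winv_reduced ra /noncancel linvK.
rewrite reduced_cons ra na !andbT /=.
by apply: contraNneq (na true) => ->; rewrite /starts eqxx.
Qed.

(** * Telescoping products of conjugates *)

Definition head_word (L : seq (nat * word)) : word := if L is b :: _ then b.2 else [::].

(** For [L] with entries (p_k, w_k) this is the product of the w_k^-1 t_(p_k) w_k without its
    initial w_1^-1. Each factor w_k w_(k+1)^-1 is reduced separately, and the last factor comes from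
    the last w_k alone because [head_word [::]] is empty. *)
Fixpoint telescope (L : seq (nat * word)) : word :=
  if L is a :: L' then (a.1, true) :: red (a.2 ++ winv (head_word L')) ++ telescope L' else [::].

Definition eltprod (L : seq (nat * word)) : fgroup := \prod_(a <- L) elt a.

(* For [a], [b] the images of [t_i], [t_(i+1)] under [phi]: [moveA] says that
   [sigma_i^-1 phi] is shorter than [phi], [moveD] that [sigma_i phi] is. *)
Definition moveA (a b : nat * word) := starts (a.1, false) (red (a.2 ++ winv b.2)).
Definition moveD (a b : nat * word) := starts (b.1, true) (red (b.2 ++ winv a.2)).
Definition stuck (a b : nat * word) := ~~ moveA a b && ~~ moveD a b.

(** If a letter of [a.2] survived the cancellation, the first letter of [a.2] would head the result,
    and [canon] forbids it to be t_(a.1)^±1. So [b] absorbs all of [a.2], and its next letter is the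
    inverse of the visible one. *)
Lemma starts_divr a (b : word) e : canon a -> reduced b ->
  starts (a.1, e) (red (a.2 ++ winv b)) -> exists y, b = y ++ (a.1, ~~ e) :: a.2.
Proof.
case/canonP=> ra na rb; have [a1 [b1 [c [ea eb ->]]]] := reduced_divr ra rb.
case: a1 ea => [|x a1] ea /startsP[r]; last first.
  by case=> ex _; have := na e; rewrite ea ex /starts /= eqxx.
move=> /= er; exists (winv r); rewrite eb -(winvK b1) er winv_cons ea /=.
by rewrite cat_rcons.
Qed.

Lemma cls_telescope L : cls (telescope L) = cls (head_word L) * eltprod L.
Proof.
elim: L => [|a L IH] /=; first by rewrite /eltprod big_nil mulg1.
rewrite -cat1s !cls_cat cls_red cls_cat cls_winv IH /eltprod big_cons /elt conjgE.
by rewrite !mulgA mulgVK mulgV mul1g.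
Qed.

(** The factor w_k w_(k+1)^-1 has length at least |w_k| - |w_(k+1)|. These bounds telescope to
    |w_1|, and each entry adds one letter t_(p_k). *)
Lemma size_telescope L : all canon L -> size L + size (head_word L) <= size (telescope L).
Proof.
elim: L => // a L IH /= /andP[/canonP[ra _] /IH]; rewrite size_cat.
suff : size a.2 <= size (red (a.2 ++ winv (head_word L))) + size (head_word L) by lia.
rewrite -[X in X <= _](_ : size (red (red (a.2 ++ winv (head_word L)) ++ head_word L)) = _).
  by apply: leq_trans (size_red _) _; rewrite size_cat.
by rewrite red_catl -catA -red_catr red_winvl cats0 red_id.
Qed.

(** The extreme case of the length bound: no room is left for any factor between the generator
    letters, nor for any conjugator. *)
Lemma telescope_trivial L : all canon L -> size (telescope L) = size L ->
  all (fun a => a.2 == [::]) L /\ telescope L = [seq (a.1, true) | a <- L].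
Proof.
elim: L => // a L IH /= /andP[/canonP[ra _] cL]; rewrite size_cat => e.
have le := size_telescope cL.
have hw0 : head_word L = [::] by apply: size0nil; lia.
have sL : size (telescope L) = size L by lia.
have u0 : red (a.2 ++ winv (head_word L)) = [::] by apply: size0nil; lia.
have a0 : a.2 = [::] by move: u0; rewrite hw0 cats0 red_id.
by have [-> ->] := IH cL sL; rewrite u0 a0.
Qed.

(** Let u be the factor between two neighbouring generator letters. Failure of [moveA] protects its
    left end, and failure of [moveD], which speaks of u^-1, protects its right end. If u is empty,
    two positive letters meet and cannot cancel. *)
Lemma telescope_reduced L : all canon L -> sorted stuck L -> reduced (telescope L).
Proof.
elim: L => // a L IH /= /andP[ca cL] sL.
have {IH} := IH cL (path_sorted sL).
have [ra na] := canonP ca.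
case: L cL sL => [|b L] /= => [_ _ _|].
  by rewrite !cats0 reduced_cons red_id // na.
case/andP=> cb cL /andP[/andP[nA nD] sL].
rewrite /moveD -[red (b.2 ++ _)]winvK in nD.
have e : winv (red (b.2 ++ winv a.2)) = red (a.2 ++ winv b.2).
  by rewrite -[red _]/(val (cls _)) -val_invg -cls_winv winv_cat winvK.
move: nA nD; rewrite /moveA e; set E := (b.1, true) :: _.
have := red_reduced (a.2 ++ winv b.2); set u := red _ => ru nA nD rE.
rewrite reduced_cons; case/lastP: u ru nA nD => [|u x] ru nA nD;
 first by rewrite cat0s rE andbT /starts (inj_eq Some_inj) xpair_eqE andbF.
rewrite reduced_cat ru rE andbT /noncancel /=; apply/andP; split.
  by apply: contraNN nA; case: (u).
apply: contraNneq nD => ex; rewrite -cats1 winv_cat (_ : winv [:: x] = [:: linv x]) // -ex.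
by rewrite /starts.
Qed.

(** * Positive words and the rigidity of stuck lists *)

Definition tword m n : word := [seq (k, true) | k <- iota m n].

Lemma tword_reduced m n : reduced (tword m n).
Proof. by apply: positive_reduced; apply/allP => _ /mapP[k _ ->]. Qed.

Lemma size_tword m n : size (tword m n) = n.
Proof. by rewrite size_map size_iota. Qed.

Lemma twordS m n : tword m n.+1 = (m, true) :: tword m.+1 n.
Proof. by []. Qed.

(* The lengths of the two sides of [w * t_0 ... t_(n-1) = telescope] are incompatible. *)
Lemma no_stuck_star a L : all canon (a :: L) -> sorted stuck L ->
  (if L is b :: _ then ~~ moveD a b else true) ->
  eltprod (a :: L) = cls (tword 0 (size L).+1) -> starts (0, true) (winv a.2) -> False.
Proof.
move=> cL sL nD eL /startsP[r er].
have ea : a.2 = rcons (winv r) (0, false) by rewrite -(winvK a.2) er winv_cons.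
(* The last letter t_0^-1 of [a.2] meets the leading t_0 of the product, so two letters are lost. *)
have le : size (red (a.2 ++ tword 0 (size L).+1)) < size L + size a.2.
  rewrite {1}ea cat_rcons twordS -red_catr !red_cons.
  rewrite (_ : (0, false) = linv (0, true)) // push_linv ?red_reduced // red_catr.
  apply: leq_ltn_trans (size_red _) _.
  by rewrite size_cat size_tword ea size_rcons; lia.
have [ca cL'] : canon a /\ all canon L by apply/andP.
have sz := size_telescope cL.
have eT : cls (telescope (a :: L)) = cls (a.2 ++ tword 0 (size L).+1).
  by rewrite cls_telescope eL cls_cat.
(* If the whole list is stuck, its telescope is reduced and too long for this bound. *)
have [sa|nsa] := boolP (sorted stuck (a :: L)).
  have := congr1 (fun x => size (val x)) eT.
  rewrite -[val (cls (telescope _))]/(red (telescope (a :: L))) (red_id (telescope_reduced cL sa)).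
  by move=> e; move: sz; rewrite e /=; lia.
case: L cL sL nD eL le cL' sz eT nsa => [|b L] // cL sL nD eL le cL' sz eT nsa.
(* Only the first pair can fail, and only through [moveA]. Then [b.2] ends in t_(a.1) followed by
   [a.2], so peeling y^-1 off the telescope leaves the telescope of the tail. That one is reduced,
   and the same length count applies to it. *)
have mA : moveA a b by apply: contraNT nsa => nA; apply/andP; split=> //; apply/andP.
have [rb _] := canonP (proj1 (andP cL')).
have [y ey] := starts_divr ca rb mA.
have := size_telescope cL'; rewrite /head_word ey.
suff : size (telescope (b :: L)) <= size y + size (red (a.2 ++ tword 0 (size L).+2)).
  move: le; rewrite size_cat [size (b :: L)]/= [size (_ :: a.2)]/=.
  set R := size (red _); set t := size (telescope _); move: R t (size y) (size a.2) (size L); lia.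
rewrite -[telescope _](red_id) ?telescope_reduced //.
rewrite -[red _]/(val (cls (telescope (b :: L)))).
have -> : cls (telescope (b :: L)) = cls y * cls (a.2 ++ tword 0 (size L).+2).
  have eu : cls (red (a.2 ++ winv b.2)) = (cls y * tgen a.1)^-1.
    rewrite cls_red cls_cat cls_winv ey -cat1s !cls_cat !invgM /= !mulgA.
    by rewrite mulgV mul1g.
  rewrite -eT -[telescope (a :: _)]/
   ([:: (a.1, true)] ++ (red (a.2 ++ winv b.2) ++ telescope (b :: L))).
  by rewrite cls_cat cls_cat eu !mulgA mulgV mul1g.
rewrite val_mulg; apply: leq_trans (size_red _) _.
by rewrite size_cat leq_add2r; apply: size_red.
Qed.

(** With w_1^-1 put back the telescope is still reduced, so it agrees with the positive word letter
    by letter. Comparing lengths forces w_1 to be empty, and then all w_k. *)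
Lemma stuck_identity p L : all canon L -> sorted stuck L ->
  eltprod L = cls (tword p (size L)) -> L = [seq (k, [::]) | k <- iota p (size L)].
Proof.
move=> cL sL eL; have rL := telescope_reduced cL sL.
have eT : cls (winv (head_word L) ++ telescope L) = cls (tword p (size L)).
  by rewrite cls_cat cls_winv cls_telescope mulKg.
have rT : reduced (winv (head_word L) ++ telescope L).
  case: L cL rL {sL eL eT} => // b L /= /andP[/canonP[rb nb] _] rL.
  case: (b.2) rb nb rL => // x w rb nb rL.
  rewrite winv_cons reduced_cat -winv_cons winv_reduced rb /noncancel linvK /=.
  by rewrite rL andbT; apply: contraNneq (nb true) => <-; rewrite /starts.
have {}eT : winv (head_word L) ++ telescope L = tword p (size L).
  by have := congr1 val eT; rewrite /= !red_id ?tword_reduced.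
have hw0 : head_word L = [::].
  have := congr1 size eT; rewrite size_cat size_winv size_tword => e.
  by have := size_telescope cL => ?; apply: size0nil; lia.
rewrite hw0 /= in eT.
have [t0 te] := telescope_trivial cL (etrans (congr1 size eT) (size_tword _ _)).
rewrite te in eT.
apply: (@eq_from_nth _ (0, [::])); first by rewrite size_map size_iota.
move=> i ltiL; have := congr1 (fun w => nth (0, true) w i) eT.
rewrite (nth_map (0, [::])) // /tword !(nth_map 0) ?size_iota //.
have /eqP := allP t0 _ (mem_nth (0, [::]) ltiL).
by case: (nth _ L i) => q w /= -> [->].
Qed.

(** * Shortening moves and the braid words they produce *)

Lemma unsorted_split (A : Type) (r : rel A) s : ~~ sorted r s ->
  exists s1 a b s2, s = s1 ++ [:: a, b & s2] /\ ~~ r a b.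
Proof.
elim: s => // a [|b s] IH //=; rewrite negb_and => /orP[nr|/IH].
  by exists [::], a, b, s.
by case=> s1 [c [d [s2 [-> nr]]]]; exists (a :: s1), c, d, s2.
Qed.

(** Here [b.2] is y t_(a.1) [a.2], and multiplying it by the inverse of [elt a] gives y [a.2], one
    letter shorter. *)
Lemma moveA_shorter a b : canon a -> canon b -> moveA a b ->
  exists c, [/\ canon c, size c.2 < size b.2 & elt c = elt b ^ (elt a)^-1].
Proof.
move=> ca /canonP[rb _] mA; have [y ey] := starts_divr ca rb mA.
have [w [cw le ew]] := conj_canon b.1 (cls (y ++ a.2)).
exists (b.1, w); split=> //.
  apply: leq_ltn_trans le _; apply: leq_ltn_trans (size_red _) _.
  by rewrite ey !size_cat /= addnS.
rewrite -ew /elt -conjgM; congr (_ ^ _).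
rewrite ey -cat1s !cls_cat conjgE !invgM invgK !mulgA.
by rewrite mulgK mulgK.
Qed.

Lemma moveD_shorter a b : canon a -> canon b -> moveD a b ->
  exists c, [/\ canon c, size c.2 < size a.2 & elt c = elt a ^ elt b].
Proof.
move=> /canonP[ra _] cb mD; have [y ey] := starts_divr cb ra mD.
have [w [cw le ew]] := conj_canon a.1 (cls (y ++ b.2)).
exists (a.1, w); split=> //.
  apply: leq_ltn_trans le _; apply: leq_ltn_trans (size_red _) _.
  by rewrite ey !size_cat /= addnS.
rewrite -ew /elt -conjgM; congr (_ ^ _).
rewrite ey -cat1s !cls_cat conjgE !mulgA mulgK.
by rewrite (_ : cls [:: _] = (tgen b.1)^-1) ?mulgVK // -cls_winv.
Qed.

Definition represents (L : seq (nat * word)) (s : seq (nat * bool)) :=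
  forall k, k < size L -> elt (nth (0, [::]) L k) = bact s (tgen k).

(** Composing with sigma_i^±1 on the left changes only the images of t_i and t_(i+1). The entries
    [a'], [b'] belong to the automorphism after the move, and the recorded letter undoes the
    move. *)
Lemma represents_cons s1 a b a' b' s2 e s :
  (if e then elt a = elt b' /\ elt a' = elt b ^ (elt a)^-1
   else elt b = elt a' /\ elt b' = elt a ^ elt b) ->
  represents (s1 ++ [:: a', b' & s2]) s ->
  represents (s1 ++ [:: a, b & s2]) ((size s1, e) :: s).
Proof.
move=> hab rep k ltk.
have sz : size (s1 ++ [:: a', b' & s2]) = size (s1 ++ [:: a, b & s2]).
  by rewrite !size_cat.
have nth0 x y : nth (0, [::]) (s1 ++ [:: x, y & s2]) (size s1) = x.
  by rewrite nth_cat ltnn subnn.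
have nth1 x y : nth (0, [::]) (s1 ++ [:: x, y & s2]) (size s1).+1 = y.
  by rewrite nth_cat ltnNge leqnSn /= subSnn.
have lt1 : (size s1).+1 < size (s1 ++ [:: a', b' & s2]).
  by rewrite size_cat /=; lia.
have := rep _ lt1; have := rep _ (ltnW lt1); rewrite nth0 nth1 => ea' eb'.
rewrite /bact /= hom_tgen bgenE -/(bact s _).
have [->|n0] := eqVneq k (size s1).
  rewrite nth0; case: e hab => -[]; first by move=> -> _.
  by move=> e1 e2; rewrite gmulfJ gmulfV /= -ea' -eb' e2 e1 conjgK.
have [->|n1] := eqVneq k (size s1).+1.
  rewrite nth1; case: e hab => -[]; last by move=> -> _.
  by move=> e1 e2; rewrite gmulfJ /= -ea' -eb' e2 e1 conjgKV.
suff -> : nth (0, [::]) (s1 ++ [:: a, b & s2]) k = nth (0, [::]) (s1 ++ [:: a', b' & s2]) k.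
  by rewrite rep ?sz //; case: (e).
rewrite !nth_cat; case: ltnP => // le.
(* Beyond the two changed positions the index is a double successor, so [nth] skips both entries. *)
suff -> : k - size s1 = (k - size s1).-2.+2 by [].
by move/eqP: n0 n1 => n0 /eqP; move: le n0; move: (size s1) => p; lia.
Qed.

Lemma eltprod_swap s1 a b a' b' s2 : elt a * elt b = elt a' * elt b' ->
  eltprod (s1 ++ [:: a', b' & s2]) = eltprod (s1 ++ [:: a, b & s2]).
Proof. by move=> e; rewrite /eltprod !big_cat /= !big_cons ![elt _ * (elt _ * _)]mulgA e. Qed.

Definition weight (L : seq (nat * word)) := sumn [seq size a.2 | a <- L].

Lemma weight_cat L1 L2 : weight (L1 ++ L2) = weight L1 + weight L2.
Proof. by rewrite /weight map_cat sumn_cat. Qed.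

(** The moves are Hurwitz moves, ab = (a b a^-1) a = b (b^-1 a b): they keep the product and here
    shorten one conjugator. *)
Lemma move_exists s1 a b s2 : all canon (s1 ++ [:: a, b & s2]) -> ~~ stuck a b ->
  exists a' b' e,
   [/\ all canon (s1 ++ [:: a', b' & s2]),
       weight (s1 ++ [:: a', b' & s2]) < weight (s1 ++ [:: a, b & s2]),
       eltprod (s1 ++ [:: a', b' & s2]) = eltprod (s1 ++ [:: a, b & s2]) &
       forall s, represents (s1 ++ [:: a', b' & s2]) s ->
       represents (s1 ++ [:: a, b & s2]) ((size s1, e) :: s)].
Proof.
rewrite all_cat /= => /and4P[c1 ca cb c2]; rewrite negb_and !negbK => /orP[mA|mD].
  have [c [cc lt ec]] := moveA_shorter ca cb mA.
  exists c, a, true; split.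
  - by rewrite all_cat /= c1 cc ca.
  - by rewrite !weight_cat ltn_add2l /weight /= addnCA ltn_add2l ltn_add2r.
  - by apply: eltprod_swap; rewrite ec -conjgCV.
  - by move=> s; apply: represents_cons; split.
have [c [cc lt ec]] := moveD_shorter ca cb mD.
exists b, c, false; split.
- by rewrite all_cat /= c1 cc cb.
- by rewrite !weight_cat ltn_add2l /weight /= addnCA ltn_add2r.
- by apply: eltprod_swap; rewrite ec -conjgC.
- by move=> s; apply: represents_cons; split.
Qed.

(** Induction on the total length of the conjugators. An unstuck pair in [L] is moved without using
    index 0, that is, sigma_1. Once [L] is stuck, either [a] is t_0 and [L] lists the remaining
    generators, or the length argument forces [moveD] on the first pair, which contributes
    sigma_1^-1 and never sigma_1. *)
Lemma larue a L : all canon (a :: L) ->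
  eltprod (a :: L) = cls (tword 0 (size L).+1) ->
  starts (0, true) (val (elt a)) ->
  exists s, [/\ all (fun c => (c.1 < size L) && ((c.1 == 0) ==> ~~ c.2)) s,
                a.2 = [::] -> all (fun c => 0 < c.1) s &
                represents (a :: L) s].
Proof.
have [m] := ubnP (weight (a :: L)); elim: m a L => // m IH a L ltm cL eL sta.
have [ca cL'] : canon a /\ all canon L by apply/andP.
have [sL|/unsorted_split[s1 [x [y [s2 [e nst]]]]]] := boolP (sorted stuck L); last first.
  have := @move_exists (a :: s1) x y s2; rewrite !cat_cons -e.
  case=> // x' [y' [b [cL1 ltw eL1 rep]]].
  have szL : size (s1 ++ [:: x', y' & s2]) = size L by rewrite e !size_cat.
  have [|//|||s [als als0 reps]] := IH a (s1 ++ [:: x', y' & s2]).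
  - by apply: leq_trans ltw _; rewrite -ltnS.
  - by rewrite eL1 eL szL.
  - by [].
  (* The pair sits behind [a], so the new index is positive. *)
  exists ((size (a :: s1), b) :: s); split; last exact: rep.
    by rewrite szL in als; rewrite /= als !andbT e size_cat /= !addnS !ltnS leq_addr.
  by move=> /als0 /=.
have [a0|na0] := eqVneq a.2 [::].
  have ea : elt a = tgen 0.
    rewrite /elt a0 conjg1; move: sta; rewrite val_elt // a0 => /startsP[r [->]].
    by [].
  have eL' : eltprod L = cls (tword 1 (size L)).
    apply: (mulgI (tgen 0)); rewrite -cls_cat -[_ ++ _]/(tword 0 (size L).+1) -eL.
    by rewrite /eltprod big_cons ea.
  have hL := stuck_identity cL' sL eL'.
  exists [::]; split=> // -[|k] /= ltk; first by rewrite ea.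
  by rewrite hL (nth_map 0) ?size_iota // nth_iota // /elt /= conjg1.
have stw : starts (0, true) (winv a.2).
  by move: sta na0; rewrite val_elt // -(size_eq0 a.2) -(size_winv a.2); case: (winv a.2).
case: L cL eL sL ltm cL' => [|b L] cL eL sL ltm cL'.
  by case: (no_stuck_star cL sL).
have [mD|nD] := boolP (moveD a b); last by case: (no_stuck_star cL sL nD eL stw).
have [cb cL2] : canon b /\ all canon L by apply/andP.
have [c [cc lt ec]] := moveD_shorter ca cb mD.
have [||||s [als _ reps]] := IH b (c :: L).
- apply: leq_trans _ (ltm : weight [:: a, b & L] <= m).
  by rewrite /weight /= addnCA ltn_add2r.
- by rewrite /= cb cc.
- rewrite -eL; apply: (@eltprod_swap [::]).
  by rewrite ec -conjgC.
(* The conjugator [a.2] ends in t_(b.1)^-1 [b.2], so its inverse and [elt b] share their first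
   letter; the new first entry still starts with t_0. *)
- have [y ey] := starts_divr cb (proj1 (canonP ca)) mD.
  move: stw; rewrite ey val_elt // winv_cat winv_cons.
  by rewrite cat_rcons; case: (winv b.2).
exists ((0, false) :: s); split=> //=.
- by move=> a0; rewrite a0 eqxx in na0.
- by apply: (@represents_cons [::] _ _ b c).
Qed.

(** * First letters of images under the inverse of sigma_i *)

Lemma ev_reduced_ind (X : nat -> fgroup) (P : letter -> fgroup -> Prop) :
  (forall a, P a (lval X a)) ->
  (forall a b y, b != linv a -> P b y -> P a (lval X a * y)) ->
  forall a w, reduced (a :: w) -> P a (ev X (a :: w)).
Proof.
move=> P1 PM a w; elim: w a => [|b w IH] a.
  by rewrite ev_cons ev_nil mulg1.
by rewrite ev_cons => /andP[nab rw]; apply: PM nab _; apply: IH.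
Qed.

Lemma cls_cancel u c v : cls (u ++ [:: c, linv c & v]) = cls (u ++ v).
Proof.
rewrite !cls_cat; congr (_ * _); apply: cls_eq; rewrite !red_cons.
by rewrite -{1}(linvK c) push_linv ?red_reduced.
Qed.

(* The possible beginnings of the image under the inverse of [sigma i] of a
   reduced word with a given first letter. *)
Inductive sigma_inv_shape (i : nat) : letter -> word -> Prop :=
| Shape_i b r : sigma_inv_shape i (i, b) [:: (i, true), (i.+1, b) & r]
| Shape_Si r of ~~ starts (i.+1, true) r & ~~ starts (i.+1, false) r :
    sigma_inv_shape i (i.+1, true) ((i, true) :: r)
| Shape_SiV r : sigma_inv_shape i (i.+1, false) ((i, false) :: r)
| Shape_SiV' b r : sigma_inv_shape i (i.+1, false) ((i.+1, b) :: r)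
| Shape_other k b r of k <> i & k <> i.+1 : sigma_inv_shape i (k, b) ((k, b) :: r).

Lemma lval_sigma_inv i a : lval (bgen (i, false)) a =
  cls (if a.1 == i then [:: (i, true); (i.+1, a.2); (i, false)]
       else if a.1 == i.+1 then [:: (i, a.2)] else [:: a]).
Proof.
case: a => k [] //; rewrite /lval /= /bgen /=.
by rewrite -cls_winv /sigma_inv; case: (k == i) => //; case: (k == i.+1).
Qed.

(** At most one pair t_i^-1 t_i cancels between the new image and [v]. When it cancels against a
    word of shape [Shape_Si], the side conditions there keep the exposed t_(i+1)^±1 from cancelling
    too. *)
Lemma sigma_inv_shape_mul i a b v : sigma_inv_shape i b v -> reduced v ->
  b != linv a -> exists v', [/\ lval (bgen (i, false)) a * cls v = cls v',
                               reduced v' & sigma_inv_shape i a v'].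
Proof.
have ni : (i.+1 == i) = false by apply/eqP; lia.
have ni' : (i == i.+1) = false by apply/eqP; lia.
have rE c w : starts c (c :: w) by rewrite /starts eqxx.
have sE (c d : letter) w : starts c (d :: w) = (d == c) by rewrite /starts (inj_eq Some_inj).
rewrite lval_sigma_inv -cls_cat; case: a => k c /=.
have [->|/eqP nk0] := eqVneq k i; last have [->|/eqP nk1] := eqVneq k i.+1.
- case=> [b1 r|r s1 s2|r|b1 r|k1 b1 r n1 n2] rv nb.
  + have {nb}eb : b1 = c.
      by move: nb; rewrite xpair_eqE eqxx; case: (b1); case: (c).
    exists [:: (i, true), (i.+1, c), (i.+1, c) & r]; subst b1; split; last by constructor.
      exact: (@cls_cancel [:: (i, true); (i.+1, c)]).
    move: rv; rewrite reduced_cons => /andP[_ rv].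
    by rewrite 2!reduced_cons rv !sE /linv /= !xpair_eqE ni /=; case: (c); rewrite andbF.
  + exists [:: (i, true), (i.+1, c) & r]; split; last by constructor.
      exact: (@cls_cancel [:: (i, true); (i.+1, c)]).
    move: rv; rewrite reduced_cons => /andP[_ rv].
    by rewrite 2!reduced_cons rv !sE /linv /= !xpair_eqE ni /= andbT; case: (c).
  + exists [:: (i, true), (i.+1, c), (i, false), (i, false) & r]; split=> //; last by constructor.
    by rewrite 3!reduced_cons rv !sE /linv /= !xpair_eqE ni ni' /= andbF.
  + exists [:: (i, true), (i.+1, c), (i, false), (i.+1, b1) & r]; split=> //; last by constructor.
    by rewrite 3!reduced_cons rv !sE /linv /= !xpair_eqE ni ni'.
  + exists [:: (i, true), (i.+1, c), (i, false), (k1, b1) & r]; split=> //; last by constructor.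
    rewrite 3!reduced_cons rv !sE /linv /= !xpair_eqE ni ni' /=.
    by move/eqP/negbTE: n1 => ->.
- case: c => -[b1 r|r s1 s2|r|b1 r|k1 b1 r n1 n2] rv nb.
  + exists [:: (i, true), (i, true), (i.+1, b1) & r]; split=> //.
      by rewrite reduced_cons rv sE /linv /= xpair_eqE andbF.
    by constructor; rewrite sE xpair_eqE ni'.
  + exists [:: (i, true), (i, true) & r]; split=> //.
      by rewrite reduced_cons rv sE /linv /= xpair_eqE andbF.
    by constructor; rewrite sE xpair_eqE ni'.
  + by rewrite /linv eqxx in nb.
  + by rewrite /linv eqxx in nb.
  + move/eqP/negbTE: (n1) => n1'; move/eqP/negbTE: (n2) => n2'.
    exists [:: (i, true), (k1, b1) & r]; split=> //.
      by rewrite reduced_cons rv sE /linv /= xpair_eqE n1'.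
    by constructor; rewrite sE xpair_eqE n2'.
  + exists ((i.+1, b1) :: r); split; last by constructor.
      exact: (@cls_cancel [::]).
    by move: rv; rewrite reduced_cons => /andP[].
  + by rewrite /linv eqxx in nb.
  + exists [:: (i, false), (i, false) & r]; split=> //; last by constructor.
    by rewrite reduced_cons rv sE /linv /= xpair_eqE andbF.
  + exists [:: (i, false), (i.+1, b1) & r]; split=> //; last by constructor.
    by rewrite reduced_cons rv sE /linv /= xpair_eqE ni.
  + exists [:: (i, false), (k1, b1) & r]; split=> //; last by constructor.
    by move/eqP/negbTE: (n1) => n1'; rewrite reduced_cons rv sE /linv /= xpair_eqE n1'.
- move/eqP/negbTE: (nk0) => nk0'; move/eqP/negbTE: (nk1) => nk1' sh rv nb.
  exists ((k, c) :: v); split=> //; last by constructor.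
  rewrite reduced_cons rv andbT.
  case: sh nb {rv} => [b1 r|r s1 s2|r|b1 r|k1 b1 r n1 n2] nb;
   by rewrite sE //= /linv xpair_eqE eq_sym ?nk0' ?nk1'.
Qed.

Lemma sigma_inv_starts i a w : reduced (a :: w) ->
  exists2 v, ev (bgen (i, false)) (a :: w) = cls v & reduced v /\ sigma_inv_shape i a v.
Proof.
apply: (ev_reduced_ind (P := fun a x => exists2 v, x = cls v & reduced v /\ sigma_inv_shape i a v)).
  have ni : (i.+1 == i) = false by apply/eqP; lia.
  have ni' : (i == i.+1) = false by apply/eqP; lia.
  case=> k c; rewrite lval_sigma_inv /=.
  have [->|/eqP nk0] := eqVneq k i; last have [->|/eqP nk1] := eqVneq k i.+1.
  - exists [:: (i, true); (i.+1, c); (i, false)] => //; split; last by constructor.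
    by rewrite /reduced /= /noncancel /linv /= !xpair_eqE ni ni'.
  - by exists [:: (i, c)] => //; split=> //; case: c; constructor.
  - by exists [:: (k, c)] => //; split=> //; constructor.
move=> {w}a b y nab [v -> [rv sh]].
by have [v' [e rv' sh']] := sigma_inv_shape_mul sh rv nab; exists v'.
Qed.

(** * Prefixes t_0 ... t_(k-1) and the mirror involution *)

Definition tprefix k : fgroup := cls (tword 0 k).

Lemma tword_cat m p q : tword m (p + q) = tword m p ++ tword (m + p) q.
Proof. by rewrite /tword iotaD map_cat. Qed.

Lemma tprefix_succ k : tprefix k.+1 = tprefix k * tgen k.
Proof. by rewrite /tprefix -addn1 tword_cat cls_cat. Qed.

Lemma tgen_tprefix k : tgen k = (tprefix k)^-1 * tprefix k.+1.
Proof. by rewrite tprefix_succ mulKg. Qed.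

(** Since t_k = P_k^-1 P_(k+1), writing P_k for [tprefix k], the prefixes generate the group. Both
    the mirror and each sigma_i act on them more simply than on the t_k. *)
Lemma eq_morph_tprefix (G : groupType) (f g : UMagmaMorphism.type fgroup G) :
  (forall k, f (tprefix k) = g (tprefix k)) -> f =1 g.
Proof.
move=> e x; rewrite -(hom_id x) !hom_comp; apply: eq_hom => k /=.
by rewrite tgen_tprefix !gmulfM !gmulfV !e.
Qed.

(** These values are forced by requiring each P_k to go to its inverse. *)
Definition mirror k : fgroup := tprefix k * (tprefix k.+1)^-1.

Lemma mirror_tprefix k : hom mirror (tprefix k) = (tprefix k)^-1.
Proof.
elim: k => [|k IH]; first by rewrite /tprefix hom_cls ev_nil invg1.
by rewrite tprefix_succ gmulfM /= IH hom_tgen /mirror mulKg -tprefix_succ.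
Qed.

Lemma mirrorK x : hom mirror (hom mirror x) = x.
Proof.
rewrite hom_comp -[RHS]hom_id; apply: eq_hom => k /=.
by rewrite /mirror gmulfM gmulfV /= !mirror_tprefix invgK -tgen_tprefix.
Qed.

(** Both sigma_i^±1 preserve t_i t_(i+1), so P_(i+1), which ends between these two letters, is the
    only prefix that moves. *)
Lemma bgen_tprefix i b k : hom (bgen (i, b)) (tprefix k) =
  if k == i.+1 then
    if b then tprefix i * (tprefix i.+1)^-1 * tprefix i.+2
    else tprefix i.+2 * (tprefix i.+1)^-1 * tprefix i
  else tprefix k.
Proof.
have ni : (i.+1 == i) = false by apply/eqP; lia.
have ni' : (i.+2 == i.+1) = false by apply/eqP; lia.
have lt m : m <= i -> hom (bgen (i, b)) (tprefix m) = tprefix m.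
  elim: m => [|m IH] lem; first by rewrite /tprefix hom_cls ev_nil.
  rewrite tprefix_succ gmulfM /= IH ?hom_tgen ?bgenE 1?ltnW // -tprefix_succ.
  have -> : (m == i) = false by apply/eqP; lia.
  have -> : (m == i.+1) = false by apply/eqP; lia.
  by rewrite if_same tprefix_succ.
have ei : hom (bgen (i, b)) (tprefix i.+1) =
    if b then tprefix i * (tprefix i.+1)^-1 * tprefix i.+2
    else tprefix i.+2 * (tprefix i.+1)^-1 * tprefix i.
  rewrite {1}tprefix_succ gmulfM /= lt // hom_tgen bgenE eqxx.
  case: b {lt}; first by rewrite -mulgA -tgen_tprefix.
  by rewrite conjgE invgK !tprefix_succ invgM !mulgA mulgVK.
have [->//|nk] := eqVneq k i.+1.
case: (leqP k i) => [/lt//|ltik].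
have {nk ltik} [m ->] : exists m, k = i.+2 + m by exists (k - i.+2); move/eqP: nk; lia.
elim: m => [|m IH].
  rewrite addn0 tprefix_succ gmulfM /= ei hom_tgen bgenE ni eqxx.
  case: b {lt ei}; first by rewrite conjgE !tprefix_succ invgM !mulgA !mulgVK mulgK.
  by rewrite !tprefix_succ invgM !mulgA !mulgVK.
rewrite addnS tprefix_succ gmulfM /= IH hom_tgen bgenE.
have -> : (i.+2 + m == i) = false by apply/eqP; lia.
have -> : (i.+2 + m == i.+1) = false by apply/eqP; lia.
by rewrite if_same.
Qed.

(** It suffices to compare on prefixes. Inverting each P in P_i P_(i+1)^-1 P_(i+2), and then the
    whole product, reverses the order of the factors, which gives the formula for the inverse
    generator. *)
Lemma mirror_bgen a x : hom mirror (hom (bgen a) (hom mirror x)) = hom (bgen (flip a)) x.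
Proof.
case: a => i b; apply: (eq_morph_tprefix (f := hom mirror \o hom (bgen (i, b)) \o hom mirror)).
move=> k /=; rewrite mirror_tprefix gmulfV /= !bgen_tprefix gmulfV /=.
case: ifP => _; last by rewrite mirror_tprefix invgK.
by case: b; rewrite !gmulfM !gmulfV /= !mirror_tprefix !invgM !invgK mulgA.
Qed.

Lemma mirror_bact s x : hom mirror (bact s (hom mirror x)) = bact (map flip s) x.
Proof.
elim: s x => [|a s IH] x; first exact: mirrorK.
by rewrite /bact /= -!/(bact _ _) -mirror_bgen -IH mirrorK.
Qed.

Definition lev (a : letter) := if a.2 then a.1 else a.1.+1.

Lemma lval_mirror a : lval mirror a = tprefix (lev a) * (tprefix (lev (linv a)))^-1.
Proof. by case: a => k []; rewrite /lval /lev //= invgM invgK. Qed.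

(* The image under [mirror] of a reduced word starting with [a] is
   [t_0 ... t_(lev a - 1)] followed by a tail whose first letter satisfies
   [tail_head a]. *)
Definition tail_head (a b : letter) :=
  if a.2 then (if b.2 then a.1 < b.1 else a.1 <= b.1)
  else (if b.2 then b.1 <= a.1 else b.1 < a.1).

Definition tail_ok (a : letter) (r : word) :=
  reduced r && (if r is b :: _ then tail_head a b else true).

(** The positive block ends in t_(lev a - 1), and [tail_head a] excludes its inverse as first letter
    of [r]. *)
Lemma tword_cat_reduced m a r : m < lev a -> tail_ok a r ->
  reduced (tword m (lev a - m) ++ r).
Proof.
move=> ltm /andP[rr hr].
have e : tword m (lev a - m) = rcons (tword m (lev a - m).-1) ((lev a).-1, true).
  have {1}-> : lev a - m = (lev a - m).-1 + 1 by lia.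
  by rewrite tword_cat cats1; congr (rcons _ (_, _)); lia.
case: r rr hr => [|b r] rr hr; first by rewrite cats0 tword_reduced.
rewrite e reduced_cat -e tword_reduced rr andbT /noncancel /linv /=.
move: hr; rewrite /tail_head /lev; case: a ltm {e} => k [] /= ltm; case: b rr => j [] //= _ hr.
  by rewrite xpair_eqE andbF.
  apply/eqP => -[]; rewrite /lev /= in ltm; lia.
  by rewrite xpair_eqE andbF.
by apply/eqP => -[]; lia.
Qed.

Lemma winv_tword_cat_reduced m n b r : m = lev b -> m < n -> tail_ok b r ->
  reduced (winv (tword m (n - m)) ++ r).
Proof.
move=> em ltmn /andP[rr hr].
have -> : n - m = (n - m).-1.+1 by lia.
rewrite twordS winv_cons; case: r rr hr => [|c r] rr hr.
  by rewrite cats0 -winv_cons -twordS winv_reduced tword_reduced.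
rewrite reduced_cat -winv_cons -twordS winv_reduced tword_reduced rr andbT /noncancel linvK.
apply: contraTneq hr => ->; rewrite em /tail_head /lev /=.
by case: b {em} => k [] /=; lia.
Qed.

Lemma mirror_reduced a w : reduced (a :: w) ->
  exists2 r, ev mirror (a :: w) = cls (tword 0 (lev a) ++ r) & tail_ok a r.
Proof.
apply: (ev_reduced_ind (P := fun a x => exists2 r, x = cls (tword 0 (lev a) ++ r) & tail_ok a r)).
  move=> {w}a; rewrite lval_mirror; exists (winv (tword 0 (lev (linv a)))).
    by rewrite cls_cat cls_winv.
  rewrite /tail_ok winv_reduced tword_reduced /=.
  case: a => k b; case: b; rewrite /lev /=.
    by rewrite -addn1 tword_cat winv_cat /= /tail_head /=.
  by case: k => // k; rewrite -addn1 tword_cat winv_cat /= /tail_head /= addn1.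
move=> {w}a b y nba [r -> okr]; rewrite lval_mirror cls_cat -/(tprefix _).
set n1 := lev (linv a); set m := lev b.
(* The part P_(n1)^-1 P_m between two letters collapses to an inverted block, to a positive block,
   or to nothing. *)
case: (ltngtP m n1) => cmp.
- exists (winv (tword m (n1 - m)) ++ r).
    rewrite [in RHS]cls_cat -/(tprefix _) cls_cat cls_winv !mulgA; congr (_ * _).
    rewrite -!mulgA; congr (_ * _).
    rewrite /tprefix -{1}(subnKC (ltnW cmp)) tword_cat cls_cat invgM mulgVK.
    by rewrite add0n.
  rewrite /tail_ok (winv_tword_cat_reduced _ cmp okr) //=.
  have -> : n1 - m = (n1 - m).-1 + 1 by lia.
  rewrite tword_cat winv_cat /=.
  have -> : m + (n1 - m).-1 = n1.-1 by lia.
  by move: cmp; rewrite /tail_head /n1 /lev /=; case: (a) => k [] /=; lia.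
- exists (tword n1 (m - n1) ++ r).
    rewrite [in RHS]cls_cat -/(tprefix _) cls_cat !mulgA; congr (_ * _).
    rewrite -!mulgA; congr (_ * _).
    by rewrite /tprefix -{1}(subnKC (ltnW cmp)) tword_cat cls_cat mulKg.
  rewrite /tail_ok (tword_cat_reduced cmp okr) /=.
  have -> : m - n1 = (m - n1).-1.+1 by lia.
  rewrite twordS /= /tail_head /n1 /lev /=; by case: (a) => k [] /=.
(* Equal levels without cancellation mean equal signs and adjacent indices, so the tail condition
   for [b] implies the one for [a]. *)
- exists r; first by rewrite -cmp mulgA mulgVK cls_cat.
  move: okr cmp nba; rewrite /tail_ok /n1 /m /lev /=; case/andP=> -> /=.
  case: r => // c r; rewrite /tail_head /linv.
  case: (a) (b) => k [] [l []] /=; rewrite xpair_eqE /= ?andbT ?andbF;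
   case: (c.2) => //= h e /eqP; lia.
Qed.

(** Only the letter t_0 has level 0, so with any other first letter the image begins with a nonempty
    prefix block. *)
Lemma mirror_starts (x : fgroup) : x != 1 -> ~~ starts (0, true) (val x) ->
  starts (0, true) (val (hom mirror x)).
Proof.
case: x => -[|a w] rx; first by move/eqP; case; apply: val_inj.
rewrite /hom /= => _ na; have [r -> okr] := mirror_reduced rx.
have la : 0 < lev a.
  by case: a na {rx okr} => k [] //=; rewrite /lev /starts /=; case: k.
have := tword_cat_reduced la okr; rewrite subn0 => rr.
by rewrite /= red_id //; case: (lev a) la.
Qed.

(** * Braid words and the elements starting with t_0 *)

Definition star (x : fgroup) := starts (0, true) (val x).

Definition nonpositive (c : nat * bool) := (c.1 == 0) ==> ~~ c.2.
Definition nonnegative (c : nat * bool) := (c.1 == 0) ==> c.2.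

(** Every shape attached to the letter t_0 begins with t_0, whether [i] is 0 or not. *)
Lemma star_sigma_inv i x : star x -> star (hom (bgen (i, false)) x).
Proof.
case: x => w rw /startsP[/= r e]; subst w.
have [v ev [rv sh]] := sigma_inv_starts i rw.
rewrite /star /hom /= ev /= red_id //.
by inversion sh.
Qed.

(** For positive [i] the shapes neither create nor destroy a leading t_0; the case of sigma_i
    reduces to that of its inverse by [bgenK]. *)
Lemma star_bgen_neutral i b x : 0 < i -> star (hom (bgen (i, b)) x) = star x.
Proof.
move=> i0.
have neg y : star (hom (bgen (i, false)) y) = star y.
  case: y => -[|a w] rw; first by rewrite /star /hom /= ev_nil.
  have [v ev [rv sh]] := sigma_inv_starts i rw.
  rewrite /star /hom /= ev /= red_id // /starts.
  case: sh i0 => [c r|r _ _|r|c r|k c r _ _] i0 //=;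
   by rewrite !(inj_eq Some_inj) !xpair_eqE; case: (i) i0.
by case: b => //; rewrite -[in RHS](bgenK (i, true) x) neg.
Qed.

Lemma star_bact s x : all nonpositive s -> star x -> star (bact s x).
Proof.
elim: s x => // -[i b] s IH x /= /andP[nc ns] sx; apply: IH => //.
case: i nc => [|i] nc; last by rewrite star_bgen_neutral.
by case: b nc => // _; apply: star_sigma_inv.
Qed.

Lemma nonpositive_flip s : all nonpositive (map flip s) = all nonnegative s.
Proof. by rewrite all_map; apply: eq_all => c; rewrite /= /nonpositive /nonnegative /= negbK. Qed.

Lemma bact_star s x : all nonnegative s -> star (bact s x) -> star x.
Proof.
move=> ns /(@star_bact (rev (map flip s))).
by rewrite bactK all_rev nonpositive_flip; apply.
Qed.

Lemma bact_neutral s : all (fun c => 0 < c.1) s -> bact s (tgen 0) = tgen 0.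
Proof.
elim: s => // -[[|i] b] s IH //= alls.
by rewrite -[in RHS]IH // /bact /= hom_tgen bgenE if_same.
Qed.

(** Letters of positive index fix t_0 until the first sigma_1 sends it to t_1. By [bact_star], the
    remaining letters cannot make the image of t_1 start with t_0. *)
Lemma bact_positive s : all nonnegative s -> has (fun c => c.1 == 0) s -> ~~ star (bact s (tgen 0)).
Proof.
elim: s => // -[i b] s IH /andP[nc ns] hs; rewrite /bact /= hom_tgen bgenE -/(bact s _).
case: i nc hs => [|i] nc hs /=.
  by case: b nc {hs} => // _; apply/negP => /(bact_star ns).
by rewrite if_same; apply: IH.
Qed.

(** * Words in the first [n] generators *)

Definition nword n (w : word) := all (fun a : letter => a.1 < n) w.

Lemma nword_red n w : nword n w -> nword n (red w).
Proof.
elim: w => // a w IH /= /andP[ha /IH]; rewrite red_cons /push.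
case: (red w) => [|b r] /=; first by rewrite ha.
by case/andP=> hb hr; case: ifP => // _; rewrite /= ha hb.
Qed.

Lemma nword_winv n w : nword n (winv w) = nword n w.
Proof. by rewrite /nword winvE all_rev all_map. Qed.

Lemma nword_cat n u v : nword n (u ++ v) = nword n u && nword n v.
Proof. exact: all_cat. Qed.

Lemma nword_ev n (X : nat -> fgroup) w : (forall k, k < n -> nword n (val (X k))) ->
  nword n w -> nword n (val (ev X w)).
Proof.
move=> hX; elim: w => [|a w IH] /=; first by rewrite ev_nil.
case/andP=> ha /IH hw; rewrite ev_cons val_mulg nword_red // nword_cat hw andbT.
by rewrite /lval; case: ifP => _; rewrite ?val_invg ?nword_winv hX.
Qed.

Lemma nword_bact n s x : all (fun c => c.1.+1 < n) s -> nword n (val x) ->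
  nword n (val (bact s x)).
Proof.
elim: s x => // -[i b] s IH x /= /andP[lti alls] nx; apply: IH => //.
apply: nword_ev nx => k ltk; rewrite /bgen nword_red // /sigma /sigma_inv /=.
by case: b; case: (k == i) => /=; try (case: (k == i.+1) => /=); rewrite ?ltk ?lti ?(ltnW lti).
Qed.

(** The ambient group has infinitely many generators, while an endomorphism is controlled only below
    [n]; hence the restriction on [w]. *)
Lemma hom_bact n (X : nat -> fgroup) s w : (forall k, k < n -> X k = bact s (tgen k)) ->
  nword n w -> ev X w = bact s (cls w).
Proof.
by move=> e nw; rewrite (eq_ev_in e nw) -ev_tgen ev_morph.
Qed.

Lemma canon_list (X : nat -> fgroup) ks :
  (forall k, k \in ks -> exists q c, X k = tgen q ^ c) ->
  exists2 L, all canon L & map elt L = map X ks.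
Proof.
elim: ks => [|k ks IH] hX; first by exists [::].
have [|L cL eL] := IH; first by move=> j jks; apply: hX; rewrite inE jks orbT.
have [q [c e]] := hX k (mem_head _ _).
have [w [cw _ ew]] := conj_canon q c.
by exists ((q, w) :: L); rewrite /= ?cw ?eL // -ew e.
Qed.

Lemma star_word n (X : nat -> fgroup) : 0 < n ->
  (forall k, k < n -> exists q c, X k = tgen q ^ c) ->
  hom X (tprefix n) = tprefix n -> star (X 0) ->
  exists s, [/\ all (fun c => c.1.+1 < n) s, all nonpositive s,
                X 0 = tgen 0 -> all (fun c => 0 < c.1) s &
                forall k, k < n -> X k = bact s (tgen k)].
Proof.
case: n => // n _ hX eS sX.
have [|L cL eL] := @canon_list X (iota 0 n.+1).
  by move=> k; rewrite mem_iota add0n => /andP[_]; apply: hX.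
have eP : eltprod L = tprefix n.+1.
  rewrite /eltprod -(big_map elt predT idfun) eL big_map -eS /tprefix hom_cls /ev /tword.
  by rewrite big_map.
have szL : size L = n.+1 by rewrite -(size_map elt) eL size_map size_iota.
case: L cL eL eP szL => // a L cL [ea eL] eP [szL].
have [||s [als als0 rep]] := larue cL; [by rewrite eP szL | by rewrite ea |].
have {}als : all (fun c => c.1.+1 < n.+1) s /\ all nonpositive s.
  by apply/andP; rewrite -all_predI; apply: sub_all als => c; rewrite szL.
exists s; case: als => al1 al2; split=> //.
(* The reduced word w^-1 t w has length 2|w| + 1, whereas t_0 has length 1. *)
- rewrite -ea => eX; apply: als0; apply: size0nil.
  have := congr1 (fun x => size (val x)) eX; rewrite val_elt; last by case/andP: cL.
  by rewrite size_cat size_winv /=; lia.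
- move=> k ltk; rewrite -rep ?szL //; last by rewrite /= szL.
  rewrite -(nth_map _ (tgen 0)); last by rewrite /= szL.
  rewrite [map _ _]/= ea eL -[X 0 :: _]/(map X (iota 0 n.+1)).
  by rewrite (nth_map 0) ?size_iota // nth_iota.
Qed.

(** * Automorphisms in the braid group B_n *)

Section InB.
Variables (n : nat) (f : endo).
Hypotheses (n0 : 0 < n) (hf : inB n f).

Let F k := cls (f k).

Lemma ext_hom w : ext f w = val (hom F (cls w)).
Proof. by rewrite extE hom_cls. Qed.

Lemma f0E : ext f (gen 0) = val (F 0).
Proof. by rewrite ext_hom hom_tgen. Qed.

Lemma iswordE w : isword n w = reduced w && nword n w.
Proof. by rewrite /isword -reducedE. Qed.

Lemma nword_F k : k < n -> nword n (val (F k)).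
Proof.
case: hf => -[hw _] _ /hw; rewrite iswordE => /andP[_ nw].
exact: nword_red.
Qed.

Lemma t1starE w : t1star n w <-> [/\ reduced w, nword n w & starts (0, true) w].
Proof.
rewrite /t1star iswordE; split.
  by case=> /andP[-> ->] e; split=> //; case: w e => // a w [->].
by case=> -> -> /startsP[r ->]; split=> //=; rewrite take0.
Qed.

Lemma F_conj k : k < n -> exists q c, F k = tgen q ^ c.
Proof.
move=> ltk; case: hf => _ [_ [p /(_ (Ordinal ltk))[c [_ e]]]].
exists (p (Ordinal ltk)), (cls c); rewrite -hom_tgen -[LHS]clsK.
rewrite -ext_hom e /conj_word /wmul !cls_red cls_cat cls_red cls_cat cls_winv.
by rewrite conjgE.
Qed.

Lemma F_tprefix : hom F (tprefix n) = tprefix n.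
Proof.
case: hf => _ [ez _]; apply: invg_inj; rewrite -gmulfV /tprefix -cls_winv.
by rewrite -[LHS]clsK -ext_hom -[winv _]/(z1 n) ez.
Qed.

Lemma F_inverse : exists G : nat -> fgroup, (forall k, k < n -> nword n (val (G k))) /\
  forall w, nword n w -> hom F (ev G w) = cls w.
Proof.
case: hf => -[_ [g [hg [_ efg]]]] _; exists (fun k => cls (g k)); split.
  by move=> k /hg; rewrite iswordE => /andP[_ nw]; apply: nword_red.
move=> w nw; rewrite -ev_tgen ev_morph; apply: eq_ev_in nw => k ltk /=.
by have := cls_eq (efg k ltk); rewrite /comp ext_hom clsK.
Qed.

Lemma aut_eq_bact (g : endo) s :
  aut_eq n g (bw_eval s) <-> forall k, k < n -> cls (g k) = bact s (tgen k).
Proof.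
split=> h k ltk; first by rewrite -bw_evalE; apply: cls_eq; apply: h.
by have := h k ltk; rewrite -bw_evalE => /(congr1 val).
Qed.

Lemma isword_ext w : nword n w -> isword n (ext f w).
Proof.
by move=> nw; rewrite iswordE ext_hom fg_reduced hom_cls nword_ev //; apply: nword_F.
Qed.

Lemma F_preimage w : reduced w -> nword n w ->
  exists x, [/\ reduced x, nword n x & ext f x = w].
Proof.
move=> rw nw; have [G [nG eG]] := F_inverse.
exists (val (ev G w)); split; [exact: fg_reduced | exact: nword_ev |].
by rewrite ext_hom clsK eG // /= red_id.
Qed.

Section BraidWord.
Variable s : seq (nat * bool).
Hypothesis Fs : forall k, k < n -> F k = bact s (tgen k).

Lemma ext_bact w : nword n w -> ext f w = val (bact s (cls w)).
Proof. by move=> nw; rewrite ext_hom hom_cls (hom_bact Fs nw). Qed.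

Lemma star_cls w : reduced w -> star (cls w) = starts (0, true) w.
Proof. by move=> rw; rewrite /star /= red_id. Qed.

Lemma img_sub_star : all nonpositive s -> forall w, t1star_img n f w -> t1star n w.
Proof.
move=> ns w [x [/t1starE[rx nx sx] <-]]; apply/t1starE.
have := isword_ext nx; rewrite iswordE => /andP[-> ->]; split=> //.
by rewrite ext_bact //; apply: star_bact => //; rewrite star_cls.
Qed.

Lemma star_sub_img : all nonnegative s -> forall w, t1star n w -> t1star_img n f w.
Proof.
move=> ns w /t1starE[rw nw sw]; have [x [rx nx ex]] := F_preimage rw nw.
exists x; split=> //; apply/t1starE; split=> //.
rewrite -star_cls //; apply: (bact_star ns).
by rewrite /star -ext_bact // ex.
Qed.

Lemma t1star_gen0 : t1star n (gen 0).
Proof. by apply/t1starE; split=> //=; rewrite n0. Qed.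

Lemma negative_strict : all nonpositive s -> has (fun c => c.1 == 0) s ->
  exists w, t1star n w /\ ~ t1star_img n f w.
Proof.
(* The preimage of t_0 is its image under the inverse word, which is positive, so it does not start
   with t_0. *)
move=> ns hs; exists (gen 0); split; first exact: t1star_gen0.
case=> x [/t1starE[rx nx sx] ex].
have: ~~ star (bact (rev (map flip s)) (tgen 0)).
  apply: bact_positive; last by rewrite has_rev has_map.
  by rewrite all_rev -nonpositive_flip mapK //; case=> k b; rewrite /flip /= negbK.
have -> : tgen 0 = bact s (cls x) by rewrite -[RHS]clsK -ext_bact // ex.
by rewrite bactK star_cls // sx.
Qed.

Lemma positive_strict : all nonnegative s -> has (fun c => c.1 == 0) s ->
  exists w, t1star_img n f w /\ ~ t1star n w.
Proof.
move=> ns hs; exists (ext f (gen 0)); split.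
  by exists (gen 0); split=> //; apply: t1star_gen0.
case/t1starE=> _ _; rewrite ext_bact /= ?n0 //.
exact/negP/bact_positive.
Qed.

End BraidWord.

Lemma neutral_word : sigma1_neutral n f ->
  exists s, all (fun c => 0 < c.1) s /\ forall k, k < n -> F k = bact s (tgen k).
Proof.
case=> s [als /aut_eq_bact e]; exists s; split=> //.
by apply: sub_all als => c /andP[].
Qed.

Lemma positive_word : sigma1_positive n f ->
  exists s, [/\ all nonnegative s, has (fun c => c.1 == 0) s &
                forall k, k < n -> F k = bact s (tgen k)].
Proof.
case=> _ [s [als [hs /aut_eq_bact e]]]; exists s; split=> //.
by apply: sub_all als => c /andP[].
Qed.

Lemma negative_word : sigma1_negative n f ->
  exists s, [/\ all nonpositive s, has (fun c => c.1 == 0) s &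
                forall k, k < n -> F k = bact s (tgen k)].
Proof.
case=> g [[efg _] [_ [s [als [hs /aut_eq_bact e]]]]].
exists (rev (map flip s)); split.
- rewrite all_rev nonpositive_flip.
  by apply: sub_all als => c /andP[].
- by rewrite has_rev has_map.
- move=> k ltk; have := cls_eq (efg k ltk).
  rewrite /comp extE clsK -[cls (idE k)]/(tgen k).
  have nk : nword n (f k) by case: hf => -[hw _] _; have := hw k ltk; rewrite iswordE => /andP[].
  by rewrite (hom_bact e nk) => <-; rewrite bactK.
Qed.

Lemma a1_neutral : ext f (gen 0) = gen 0 -> sigma1_neutral n f.
Proof.
rewrite f0E => e; have F0 : F 0 = tgen 0 by apply: val_inj.
have [|s [al1 _ /(_ F0) al0 Fs]] := star_word n0 F_conj F_tprefix; first by rewrite F0.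
exists s; split; last exact/aut_eq_bact.
by apply/allP => c cs; rewrite (allP al0) // (allP al1).
Qed.

Lemma a2_negative : starts (0, true) (ext f (gen 0)) -> ext f (gen 0) <> gen 0 ->
  sigma1_negative n f.
Proof.
rewrite f0E => sF ne.
have [s [al1 aln _ Fs]] := star_word n0 F_conj F_tprefix sF.
(* A word without index 0 would fix t_0, contrary to [ne]. *)
have hs : has (fun c => c.1 == 0) s.
  apply/negPn/negP => /hasPn h; apply: ne; rewrite (Fs 0 n0) bact_neutral //.
  by apply/allP => c /h; rewrite lt0n.
set s' := rev (map flip s).
have al1' : all (fun c => c.1.+1 < n) s' by rewrite all_rev all_map.
exists (bw_eval s'); split; last first.
  split; first by case/hasP: hs => c cs /eqP c0; have := allP al1 c cs; rewrite c0.
  exists s'; split; last by split=> //; rewrite has_rev has_map.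
  rewrite all_rev all_map; apply/allP => c cs /=.
  by rewrite (allP al1 _ cs); apply: (allP aln).
have e' : forall k, k < n -> cls (bw_eval s' k) = bact s' (tgen k) by move=> k _; apply: bw_evalE.
split=> k ltk; rewrite /comp -[red (idE k)]/(val (tgen k)).
  have nk : nword n (f k) by case: hf => -[hw _] _; have := hw k ltk; rewrite iswordE => /andP[].
  by rewrite extE (hom_bact e' nk) -/(F k) Fs // bactK /= redK.
rewrite ext_hom bw_evalE /hom (hom_bact Fs) ?clsK ?bactVK /= ?redK //.
by apply: nword_bact => //=; rewrite ltk.
Qed.

Lemma a3_positive : ~~ starts (0, true) (ext f (gen 0)) -> sigma1_positive n f.
Proof.
rewrite f0E => nsF.
(* The conjugate of the automorphism by the mirror, prepared for [star_word]. *)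
pose Y k := hom mirror (hom F (mirror k)).
have homY x : hom Y x = hom mirror (hom F (hom mirror x)).
  by rewrite !hom_comp; apply: eq_hom => k; rewrite /Y /= hom_comp.
(* The mirror sends t_j to a conjugate of t_j^-1, and applying it twice undoes the inversion. *)
have Yconj k : k < n -> exists q c, Y k = tgen q ^ c.
  move=> /F_conj[q [c e]].
  have ei j : mirror j = (tgen j)^-1 ^ (tprefix j)^-1.
    by rewrite /mirror tprefix_succ conjgE invgK invgM !mulgA.
  rewrite /Y ei gmulfJ !gmulfV /= hom_tgen e gmulfJ gmulfV /= gmulfJ /= hom_tgen ei.
  by rewrite -!conjVg invgK -!conjgM; eexists; eexists.
have Ytprefix : hom Y (tprefix n) = tprefix n.
  by rewrite homY mirror_tprefix gmulfV /= F_tprefix gmulfV /= mirror_tprefix invgK.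
have Y0 : Y 0 = hom mirror (F 0)^-1.
  by rewrite /Y /mirror tprefix_succ /tprefix invgM cls_nil invg1 mulg1 mul1g gmulfV /= hom_tgen.
(* As [mirror 0] is t_0^-1, [Y 0] is the mirror of w^-1 t_q^-1 w. This word has the same first
   letter as w^-1 t_q w if w is nonempty and starts with a negative letter otherwise, so it does not
   start with t_0 and [mirror_starts] applies. *)
have sY : star (Y 0).
  rewrite Y0; have [q [c e]] := F_conj n0; have [w [cw _ ew]] := conj_canon q c.
  rewrite e ew in nsF *; rewrite val_elt // in nsF.
  have eV : val (elt (q, w))^-1 = winv w ++ (q, false) :: w.
    by rewrite val_invg val_elt // winv_cat winv_cons winvK cat_rcons.
  apply: mirror_starts; last first.
    rewrite eV; case: (winv w) nsF => //= _.
    by rewrite /starts (inj_eq Some_inj) xpair_eqE andbF.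
  by apply/eqP => /(congr1 val); rewrite eV; case: (winv w).
have [s [al1 aln _ Ys]] := star_word n0 Yconj Ytprefix sY.
(* Conjugating back by the mirror flips every letter of [s], turning a word without sigma_1 into one
   without sigma_1^-1. *)
have Fs k : k < n -> F k = bact (map flip s) (tgen k).
  move=> ltk; rewrite -mirror_bact hom_tgen -[LHS]mirrorK; congr (hom mirror _).
  have -> : hom mirror (F k) = hom Y (mirror k) by rewrite homY -(hom_tgen mirror) mirrorK hom_tgen.
  rewrite /hom (hom_bact Ys) ?clsK //.
  rewrite /mirror val_mulg val_invg nword_red // nword_cat nword_winv /tprefix.
  by rewrite !nword_red //; apply/allP => _ /mapP[j + ->]; rewrite mem_iota /=; lia.
have al1' : all (fun c => c.1.+1 < n) (map flip s) by rewrite all_map.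
have hs : has (fun c => c.1 == 0) (map flip s).
  apply/negPn/negP => /hasPn h; move: nsF; rewrite (Fs 0 n0) bact_neutral //.
  by apply/allP => c /h; rewrite lt0n.
split; first by case/hasP: hs => c cs /eqP c0; have := allP al1' c cs; rewrite c0.
exists (map flip s); split; last by split=> //; apply/aut_eq_bact.
rewrite all_map; apply/allP => c cs /=.
by rewrite (allP al1 _ cs); apply: (allP aln).
Qed.

End InB.

Local Close Scope group_scope.

Theorem theorem6p6 (n : nat) (hn : 1 <= n) (f : endo) (hf : inB n f) :
  let a1 := ext f (gen 0) = gen 0 in
  let a2 := t1star n (ext f (gen 0)) /\ ext f (gen 0) <> gen 0 in
  let a3 := ~ t1star n (ext f (gen 0)) in
  let b1 := sigma1_neutral n f in
  let b2 := sigma1_negative n f in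
  let b3 := sigma1_positive n f in
  let c1 := forall w, t1star_img n f w <-> t1star n w in
  let c2 := (forall w, t1star_img n f w -> t1star n w) /\
            (exists w, t1star n w /\ ~ t1star_img n f w) in
  let c3 := (forall w, t1star n w -> t1star_img n f w) /\
            (exists w, t1star_img n f w /\ ~ t1star n w) in
  ((a1 <-> b1) /\ (b1 <-> c1)) /\
  ((a2 <-> b2) /\ (b2 <-> c2)) /\
  ((a3 <-> b3) /\ (b3 <-> c3)) /\
  ((b1 /\ ~ b2 /\ ~ b3) \/ (~ b1 /\ b2 /\ ~ b3) \/ (~ b1 /\ ~ b2 /\ b3)).
Proof.
move=> a1 a2 a3 b1 b2 b3 c1 c2 c3.
have ab1 : a1 -> b1 by apply: a1_neutral.
have ab2 : a2 -> b2 by case=> /t1starE[_ _ st] ne; apply: a2_negative.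
have ab3 : a3 -> b3.
  move=> ns; apply: a3_positive => //; apply/negP => st; apply: ns; apply/t1starE.
  have : isword n (ext f (gen 0)) by apply: isword_ext; rewrite //= hn.
  by rewrite iswordE => /andP[].
have bc1 : b1 -> c1.
  case/neutral_word=> s [als Fs] w; split;
   [apply: (img_sub_star hf Fs) | apply: (star_sub_img hf Fs)];
   by apply: sub_all als => c; rewrite /nonpositive /nonnegative lt0n => /negbTE ->.
have bc2 : b2 -> c2.
  case/(negative_word hf)=> s [ns hs Fs]; split; first exact: (img_sub_star hf Fs).
  exact: (negative_strict hn Fs).
have bc3 : b3 -> c3.
  case/positive_word=> s [ns hs Fs]; split; first exact: (star_sub_img hf Fs).
  exact: (positive_strict hn Fs).
have c12 : c1 -> c2 -> False by move=> h1 [_ [w [hw]]]; apply; apply/h1.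
have c13 : c1 -> c3 -> False by move=> h1 [_ [w [hw]]]; apply; apply/h1.
have c23 : c2 -> c3 -> False by case=> h _ [_ [w [hw]]]; apply; apply: h.
have a123 : a1 \/ a2 \/ a3.
  have [e|ne] := eqVneq (ext f (gen 0)) (gen 0); first by left.
  have [st|nst] := boolP (starts (0, true) (ext f (gen 0))).
    right; left; split; last by apply/eqP.
    have : isword n (ext f (gen 0)) by apply: isword_ext; rewrite //= hn.
    by rewrite iswordE => /andP[rf nf]; apply/t1starE.
  by right; right=> /t1starE[_ _ st]; rewrite st in nst.
(* Hiding the bodies leaves only the propositional skeleton. *)
clearbody a1 a2 a3 b1 b2 b3 c1 c2 c3; tauto.
Qed.
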